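(* Let $N\in\mathbb{N}$. Then \begin{equation*} \sum_{j=1}^N \genfrac{[}{]}{0pt}{}{N}{j} \frac{q^{j^2} (q)_j }{(z q)_j (z^{-1} q)_j}=\sum_{n=1}^{\infty}\sum_{m=-\infty}^{\infty} N_{S_1}(m, n) z^m q^n. \end{equation*}
   Context: Here $(A)_n=(A;q)_n=(1-A)(1-Aq)\cdots(1-Aq^{n-1})$, and $\genfrac{[}{]}{0pt}{}{N}{j}=\frac{(q;q)_N}{(q;q)_j(q;q)_{N-j}}$ is the $q$-binomial coefficient. Let $V_1=\mathcal{D}\times\mathcal{P}$ be the set of vector partitions $\vec\pi=(\pi_1,\pi_2)$ with $\pi_1$ a partition into distinct parts and $\pi_2$ an unrestricted partition, $|\vec\pi|=|\pi_1|+|\pi_2|$. For $1\le j\le N$, let $S_1$ be the set of $\vec\pi\in V_1$ such that $\pi_1$ is either empty or has all its parts in $[N-j+1,N]$, and $\pi_2$ has Durfee square of size $j$. The weight is $w_r(\vec\pi)=(-1)^{\#(\pi_1)}$ (with $\#$ the number of parts) and $\mathrm{rank}(\vec\pi)=\mathrm{rank}(\pi_2)=$ largest part of $\pi_2$ minus number of parts of $\pi_2$. Define $N_{S_1}(m,n;j)=\sum w_r(\vec\pi)$ over $\vec\pi\in S_1$ (with Durfee square size $j$) with $|\vec\pi|=n$ and rank $m$, and $N_{S_1}(m,n)=\sum_{j=1}^N N_{S_1}(m,n;j)$. *)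

(* Defs.v *)
From HB Require Import structures.
From mathcomp Require Export all_boot all_order all_algebra.
From mathcomp Require Export all_classical all_reals all_analysis.
From mathcomp Require Export complex.

Set Implicit Arguments.
Unset Strict Implicit.
Unset Printing Implicit Defensive.

Import Order.TTheory GRing.Theory Num.Theory.
Import numFieldNormedType.Exports.

Local Open Scope classical_set_scope.
Local Open Scope ring_scope.

Definition qpoch (F : fieldType) (a q : F) (n : nat) : F :=
  \prod_(i < n) (1 - a * q ^+ i).

Definition qbinom (F : fieldType) (q : F) (N j : nat) : F :=
  qpoch q q N / (qpoch q q j * qpoch q q (N - j)).

Definition is_partition (s : seq nat) : bool :=
  sorted geq s && (0%N \notin s).

Definition is_distinct_partition (s : seq nat) : bool :=
  is_partition s && uniq s.

Definition largest_part (s : seq nat) : nat := (\max_(x <- s) x)%N.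

Definition partition_rank (s : seq nat) : int :=
  (largest_part s)%:Z - (size s)%:Z.

(* The d x d square fits in the Ferrers diagram of s iff s has at least d
   parts that are at least d. *)
Definition durfee (s : seq nat) : nat :=
  (\max_(d < (size s).+1 | d <= count (leq d) s) d)%N.

Notation vpart := (seq nat * seq nat)%type.

Definition V1 : set vpart :=
  [set p | is_distinct_partition p.1 /\ is_partition p.2].

Definition vsize (p : vpart) : nat := (sumn p.1 + sumn p.2)%N.

Definition vrank (p : vpart) : int := partition_rank p.2.

Definition weight_r (p : vpart) : int := (-1) ^+ size p.1.

Definition S1 (N j : nat) : set vpart :=
  [set p | [/\ V1 p,
               p.1 = [::] \/ {in p.1, forall x, (N - j + 1 <= x <= N)%N}
             & durfee p.2 = j]].

Definition S1_fiber (N : nat) (m : int) (n j : nat) : set vpart :=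
  [set p | [/\ S1 N j p, vsize p = n & vrank p = m]].

(* [\sum_(p \in A)] is a sum over a finite support, and would be 0 on an
   infinite one; [S1_fiber_finite] shows that this does not happen here. *)
Definition NS1j (N : nat) (m : int) (n j : nat) : int :=
  \sum_(p \in S1_fiber N m n j) weight_r p.

Definition NS1 (N : nat) (m : int) (n : nat) : int :=
  \sum_(1 <= j < N.+1) NS1j N m n j.

Lemma part_bounds (s : seq nat) : 0%N \notin s ->
  (size s <= sumn s)%N /\ {in s, forall x, (x <= sumn s)%N}.
Proof.
elim: s => [|x s IH] //=; rewrite inE negb_or eq_sym -lt0n => /andP[x0 /IH[h1 h2]].
split; first by rewrite -add1n leq_add.
move=> y; rewrite inE => /orP[/eqP->|/h2 h]; first exact: leq_addr.
exact: leq_trans h (leq_addl _ _).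
Qed.

Lemma S1_size_finite (N n j : nat) :
  finite_set [set p | S1 N j p /\ vsize p = n].
Proof.
pose B := [set s : seq nat | 0%N \notin s /\ (sumn s <= n)%N].
have finB : finite_set B.
  pose f (t : {k : 'I_n.+1 & k.-tuple 'I_n.+1}) : seq nat :=
    [seq val i | i <- tagged t].
  apply: (@sub_finite_set _ _ (f @` setT)); last exact/finite_image/finite_finset.
  move=> s [/part_bounds[h1 h2] h3].
  have hs : (size s < n.+1)%N by rewrite ltnS (leq_trans h1).
  have hsz : size [seq inord x : 'I_n.+1 | x <- s] == Ordinal hs by rewrite size_map.
  exists (Tagged (fun k : 'I_n.+1 => k.-tuple 'I_n.+1) (Tuple hsz)) => //.
  rewrite /f /= -map_comp -[RHS]map_id; apply/eq_in_map => x /h2 hx /=.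
  by rewrite inordK // ltnS (leq_trans hx).
apply: (@sub_finite_set _ _ (B `*` B)); last exact: finite_setX.
move=> [a b] [[[/andP[/andP[_ a0] _] /andP[_ b0]] _ _]]; rewrite /vsize /= => hn.
by split; split => //=; rewrite -hn ?leq_addr ?leq_addl.
Qed.

Lemma S1_fiber_finite (N : nat) (m : int) (n j : nat) :
  finite_set (S1_fiber N m n j).
Proof. by apply: sub_finite_set (S1_size_finite N n j) => p []. Qed.

Lemma NS1_support_finite (N n : nat) : finite_set [set m | NS1 N m n != 0].
Proof.
apply: (@sub_finite_set _ _ (\bigcup_(j in `I_N.+1)
   (vrank @` [set p | S1 N j p /\ vsize p = n]))); last first.
  apply: bigcup_finite; first exact: finite_II.
  by move=> j _; exact/finite_image/S1_size_finite.
move=> m /= /eqP nz; apply: contrapT => h; apply: nz.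
rewrite /NS1 big_nat big1 // => j /andP[_ jN].
rewrite /NS1j (_ : S1_fiber N m n j = set0) ?fsbig_set0 //.
by rewrite -subset0 => p [hp hn hm]; apply: h; exists j => //; exists p.
Qed.

(* Main.v *)
(* For fixed j, a partition with Durfee square of size j is a weakly decreasing
   sequence b of j rows of length at least j, followed by a partition c with
   parts at most j, and its rank is (head b - j) - #c.  Removing a first column
   of height k from b, a largest part from c, or a largest part from the distinct
   partition gives linear recursions for the partial sums (total size < M) of
   the weighted series.  A recursion u M = a M + c * u (M - d) with |c| < 1 and
   a convergent to A forces u to converge to A / (1 - c), so that every factor
   of the product formula is obtained directly at the level of partial sums,
   without Cauchy products or absolute convergence. *)
Require Import Defs.
From mathcomp Require Import zify lra ring.
Import Order.TTheory GRing.Theory Num.Theory.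
Import numFieldNormedType.Exports.
Local Open Scope classical_set_scope.
Local Open Scope ring_scope.
Local Open Scope complex_scope.

(** * Delay recursions *)

(** Once [dl] is small, each step back by [d] contracts the bound [K] on the initial values by [r],
    while the accumulated forcing stays below [eps / 2]. *)
Lemma delay_recursion_cvg0 (R : realType) (e dl : nat -> R) (r : R) (d : nat) :
  (0 < d)%N -> 0 <= r < 1 -> (forall M, 0 <= e M) ->
  (forall M, e M <= dl M + r * e (M - d)%N) ->
  dl @ \oo --> 0 -> e @ \oo --> 0.
Proof.
move=> d0 /andP[r0 r1] e0 eE dl0; apply/cvgr0Pnorm_le => eps eps0.
(* Chosen so that [x + r * (eps / 2) = eps / 2]: the constant part of the bound reproduces
   itself. *)
pose x := eps / 2 * (1 - r).
have x0 : 0 < x by rewrite /x; nra.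
move/cvgr0Pnorm_le : dl0 => /(_ _ x0)[M1 _ HM1].
set M0 := M1.+1; pose K := \sum_(i < M0) e i.
have K0 : 0 <= K by apply: sumr_ge0.
have bound M : e M <= eps / 2 + K * r ^+ ((M - M0) %/ d).
  have [n] := ubnP M; elim: n M => // n IH M Mn.
  have [MM0|MM0] := ltnP M M0.
    rewrite (_ : (M - M0 = 0)%N) ?div0n; last by lia.
    have : e M <= K by rewrite /K (bigD1 (Ordinal MM0)) //= lerDl sumr_ge0.
    by rewrite expr0; lra.
  have := HM1 M (ltnW MM0) => /= /ler_normlP[_ dlM].
  have /IH IHM : (M - d < n)%N by lia.
  apply: (le_trans (eE M)).
  (* Truncated subtraction can make the left exponent exceed the right one, which is harmless since
     [r <= 1]. *)
  have le_r : r * r ^+ ((M - d - M0) %/ d) <= r ^+ ((M - M0) %/ d).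
    rewrite -exprS; apply: ler_wiXn2l => //; first exact: ltW.
    rewrite -ltnS ltn_divLR// !mulSn.
    by have := divn_eq (M - d - M0) d; have := ltn_pmod (M - d - M0) d0; lia.
  apply: le_trans (lerD dlM (ler_wpM2l r0 IHM)) _.
  by have := ler_wpM2l K0 le_r; rewrite /x; lra.
have /cvgr0Pnorm_le : geometric K r @ \oo --> 0.
  by apply: cvg_geometric; rewrite ger0_norm.
have eps20 : 0 < eps / 2 by lra.
move=> /(_ _ eps20)[k _ Hk]; exists (M0 + k * d)%N => //= M /= HM.
rewrite ger0_norm//; apply: le_trans (bound M) _.
have /Hk/= : (k <= (M - M0) %/ d)%N by rewrite leq_divRL//; lia.
by move=> /ler_normlP[_]; lra.
Qed.

Lemma RRe_norm (R : realType) (x : R[i]) : (complex.Re `|x|)%:C = `|x|.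
Proof. by rewrite normc_def. Qed.

Lemma Re_norm_ge0 (R : realType) (x : R[i]) : 0 <= complex.Re `|x|.
Proof. by rewrite -lecR RRe_norm; exact: normr_ge0. Qed.

(** The norm on [R[i]] takes its values in [R[i]]; its real part links complex convergence to the
    real-valued recursion lemma. *)
Lemma cvg_normCP (R : realType) (u : nat -> R[i]) (l : R[i]) :
  (fun n => complex.Re `|u n - l|) @ \oo --> 0 <->
  (u : nat -> R[i]^o) @ \oo --> (l : R[i]^o).
Proof.
split=> [/cvgr0Pnorm_lt h|/cvgrPdist_lt h].
  apply/cvgrPdist_lt => eps eps0.
  have epsE : eps = (complex.Re eps)%:C by rewrite RRe_real// gtr0_real.
  have : 0 < complex.Re eps by move: eps0; rewrite {1}epsE ltcR.
  move=> /h; apply: filterS => n; rewrite (ger0_norm (Re_norm_ge0 _ _)).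
  by rewrite epsE -ltcR RRe_norm distrC.
apply/cvgr0Pnorm_lt => eps eps0.
have /h : 0 < eps%:C by rewrite ltcR.
apply: filterS => n; rewrite (ger0_norm (Re_norm_ge0 _ _)).
by rewrite -ltcR RRe_norm distrC.
Qed.

(** The distance to the fixed point [L = A + c * L] satisfies the real recursion with forcing
    [|a M - A|], which tends to 0. *)
Lemma delay_recursion_cvg (R : realType) (u a : nat -> R[i]) (A c : R[i])
    (d : nat) :
  (0 < d)%N -> `|c| < 1 -> (forall M, u M = a M + c * u (M - d)%N) ->
  (a : nat -> R[i]^o) @ \oo --> (A : R[i]^o) ->
  (u : nat -> R[i]^o) @ \oo --> (A / (1 - c) : R[i]^o).
Proof.
move=> d0 c1 uE aA.
have c_neq1 : 1 - c != 0.
  by rewrite subr_eq0; apply: contraTneq c1 => <-; rewrite normr1 ltxx.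
have LE : A / (1 - c) = A + c * (A / (1 - c)).
  apply: (mulIf c_neq1).
  rewrite mulrDl -!mulrA mulVf// !mulr1 mulrBr mulr1 mulrC.
  by rewrite addrNK.
move: (A / (1 - c)) LE => L LE.
have E M : u M - L = (a M - A) + c * (u (M - d)%N - L).
  by rewrite uE {1}LE opprD mulrBr addrACA.
apply/cvg_normCP.
apply: (@delay_recursion_cvg0 _ _ (fun M => complex.Re `|a M - A|)
  (complex.Re `|c|) d) => //.
- by rewrite -lecR -ltcR RRe_norm normr_ge0.
- by move=> M; exact: Re_norm_ge0.
- move=> M; rewrite -lecR rmorphD rmorphM /= !RRe_norm -normrM.
  by rewrite E; exact: ler_normD.
- exact/cvg_normCP.
Qed.

(** * Weighted partial sums over triples of sequences *)

(* The bound on the size is strict, so that a shift by d of the size becomes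
   [M - d], also when the truncated subtraction gives 0. *)
Definition psum {T : choiceType} {F : idomainType} (X : set T) (sz : T -> nat)
    (w : T -> F) (M : nat) : F :=
  \sum_(t \in X `&` [set t | (sz t < M)%N]) w t.

(** Abstract form of one removal step. The condition [szT t + d < M] amounts to [szT t < M - d] even
    when the subtraction truncates. *)
Lemma psum_image (T U : choiceType) (F : idomainType) (A : set T) (g : T -> U)
    (szT : T -> nat) (szU : U -> nat) (wT : T -> F) (wU : U -> F) (d : nat)
    (c : F) (M : nat) :
  set_inj A g -> (forall t, A t -> szU (g t) = (szT t + d)%N) ->
  (forall t, A t -> wU (g t) = c * wT t) ->
  psum (g @` A) szU wU M = c * psum A szT wT (M - d)%N.
Proof.
move=> ginj gsz gw; rewrite /psum.
have -> : g @` A `&` [set t | (szU t < M)%N] =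
    g @` (A `&` [set t | (szT t < M - d)%N]).
  apply/seteqP; split=> [y [[t At <-] /=]|y [t [At /=]]].
    by rewrite gsz// => tM; exists t => //; split=> //=; rewrite ltn_subRL addnC.
  rewrite ltn_subRL addnC => tM <-; split; first by exists t.
  by rewrite /= gsz.
rewrite fsbig_image; last first.
  by move=> x y; rewrite !inE => -[Ax _] [Ay _]; apply: ginj; rewrite inE.
rewrite mulr_fsumr; apply: eq_fsbigr => t; rewrite inE => -[At _].
exact: gw.
Qed.

Lemma psumU (T : choiceType) (F : idomainType) (A B : set T) (sz : T -> nat)
    (w : T -> F) (M : nat) :
  finite_set (A `&` [set t | (sz t < M)%N]) ->
  finite_set (B `&` [set t | (sz t < M)%N]) -> A `&` B `<=` set0 ->
  psum (A `|` B) sz w M = psum A sz w M + psum B sz w M.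
Proof.
move=> finA finB AB; rewrite /psum setIUl fsbigU0// => t [[At _] [Bt _]].
exact: AB.
Qed.

Lemma finite_seq_pos (n : nat) :
  finite_set [set s : seq nat | 0%N \notin s /\ (sumn s <= n)%N].
Proof.
elim: n => [|n IH].
  apply: (@sub_finite_set _ _ [set [::]]); last exact: finite_set1.
  by case=> [|[|x] s] //= [].
pose B := [set s : seq nat | 0%N \notin s /\ (sumn s <= n)%N].
apply: (@sub_finite_set _ _
   ([set [::]] `|` (fun p => p.1 :: p.2) @` (`I_n.+2 `*` B))); last first.
  rewrite finite_setU; split; first exact: finite_set1.
  by apply/finite_image/finite_setX => //; exact: finite_II.
case=> [|x s]; first by left.
rewrite /= inE negb_or => -[/andP[x0 s0] xs]; right.
by exists (x, s) => //=; split=> /=; [lia|split=> //; lia].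
Qed.

(** The components are the distinct partition, the rows through the Durfee square, and the rows
    below it. *)
Definition triple := (seq nat * seq nat * seq nat)%type.

Definition tsize (t : triple) : nat :=
  (sumn t.1.1 + sumn t.1.2 + sumn t.2)%N.

Definition positive_seqs : set (seq nat) := [set s : seq nat | 0%N \notin s].

(** Positive entries bound the lengths by the size. This supplies the finiteness needed to split
    partial sums with [psumU]. *)
Lemma finite_triples (A B C : set (seq nat)) (M : nat) :
  A `<=` positive_seqs -> B `<=` positive_seqs -> C `<=` positive_seqs ->
  finite_set (A `*` B `*` C `&` [set t | (tsize t < M)%N]).
Proof.
move=> Ap Bp Cp.
pose D := [set s : seq nat | 0%N \notin s /\ (sumn s <= M)%N].
have finD : finite_set D by exact: finite_seq_pos.
apply: (@sub_finite_set _ _ (D `*` D `*` D)); last by do 2 apply: finite_setX => //.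
move=> [[a b] c] [[[/= /Ap a0 /Bp b0] /Cp c0]]; rewrite /tsize /= => lM.
by split; [split|] => /=; split=> //; lia.
Qed.

Definition on1 (f : seq nat -> seq nat) (t : triple) : triple :=
  (f t.1.1, t.1.2, t.2).
Definition on2 (f : seq nat -> seq nat) (t : triple) : triple :=
  (t.1.1, f t.1.2, t.2).
Definition on3 (f : seq nat -> seq nat) (t : triple) : triple :=
  (t.1.1, t.1.2, f t.2).

Lemma on1_image f (A B C : set (seq nat)) :
  (f @` A) `*` B `*` C = on1 f @` (A `*` B `*` C).
Proof.
apply/seteqP; split=> [[[a b] c] [[/= [x Ax <-] Bb] Cc]|].
  by exists (x, b, c).
by move=> _ [[[a b] c] [[/= Aa Bb] Cc] <-]; split=> //; split=> //; exists a.
Qed.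

Lemma on2_image f (A B C : set (seq nat)) :
  A `*` (f @` B) `*` C = on2 f @` (A `*` B `*` C).
Proof.
apply/seteqP; split=> [[[a b] c] [[/= Aa [x Bx <-]] Cc]|].
  by exists (a, x, c).
by move=> _ [[[a b] c] [[/= Aa Bb] Cc] <-]; split=> //; split=> //; exists b.
Qed.

Lemma on3_image f (A B C : set (seq nat)) :
  A `*` B `*` (f @` C) = on3 f @` (A `*` B `*` C).
Proof.
apply/seteqP; split=> [[[a b] c] [[/= Aa Bb] [x Cx <-]]|].
  by exists (a, b, x).
by move=> _ [[[a b] c] [[/= Aa Bb] Cc] <-]; split=> //; exists c.
Qed.

Lemma on1_inj f (X : set triple) : injective f -> set_inj X (on1 f).
Proof. by move=> fi [[? ?] ?] [[? ?] ?] _ _ [/fi -> -> ->]. Qed.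

Lemma on2_inj f (X : set triple) : injective f -> set_inj X (on2 f).
Proof. by move=> fi [[? ?] ?] [[? ?] ?] _ _ [-> /fi -> ->]. Qed.

Lemma on3_inj f (X : set triple) : injective f -> set_inj X (on3 f).
Proof. by move=> fi [[? ?] ?] [[? ?] ?] _ _ [-> -> /fi ->]. Qed.

(** * Families of parts and rows, and their one-step decompositions *)

Definition distinct_parts (s i : nat) : set (seq nat) :=
  [set a | sorted gtn a && all (fun x => s < x <= s + i)%N a].

(* The first k rows of a diagram containing a j x j square. *)
Definition square_rows (j k : nat) : set (seq nat) :=
  [set b | [&& size b == k, sorted geq b & all (leq j) b]].

Definition bounded_parts (l : nat) : set (seq nat) :=
  [set c | sorted geq c && all (fun x => 0 < x <= l)%N c].

Lemma distinct_parts_pos s i : distinct_parts s i `<=` positive_seqs.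
Proof.
by move=> a /andP[_ /allP h]; apply/negP => /h /andP[].
Qed.

Lemma square_rows_pos j k : (0 < j)%N -> square_rows j k `<=` positive_seqs.
Proof.
move=> j0 b /and3P[_ _ /allP h]; apply/negP => /h.
by rewrite leqNgt j0.
Qed.

Lemma bounded_parts_pos l : bounded_parts l `<=` positive_seqs.
Proof. by move=> a /andP[_ /allP h]; apply/negP => /h. Qed.

Lemma distinct_parts0 s : distinct_parts s 0 = [set [::]].
Proof.
apply/seteqP; split=> [|_ ->] //.
by case=> //= x a /and3P[_ xs _]; exfalso; move: xs; lia.
Qed.

Lemma square_rows0 j : square_rows j 0 = [set [::]].
Proof. by apply/seteqP; split=> [|_ ->] //; case. Qed.

Lemma bounded_parts0 : bounded_parts 0 = [set [::]].
Proof.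
apply/seteqP; split=> [|_ ->] //.
by case=> //= x a /and3P[_ xs _]; exfalso; move: xs; lia.
Qed.

(** Case split on whether the largest allowed part occurs. It occurs at most once, so the tail falls
    back to index [i] and the induction on [i] is a finite step. *)
Lemma distinct_partsS s i :
  distinct_parts s i.+1 =
  distinct_parts s i `|` cons (s + i.+1)%N @` distinct_parts s i.
Proof.
apply/seteqP; split=> [a|a [/andP[sa /allP h]|[b /andP[sb /allP h] <-]]].
- case: a => [|x a /=] /andP[sa]; first by left.
  move=> /= /andP[hx /allP ha].
  have /allP hs : all (gtn x) a by rewrite (order_path_min _ sa)// => ? ? ? /=; lia.
  have [xE|xE] := eqVneq x (s + i.+1)%N.
    right; exists a; rewrite ?xE//; apply/andP; split; first exact: path_sorted sa.
    by apply/allP => y ya; have := ha y ya; have := hs y ya; rewrite /= xE; lia.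
  left; apply/andP; split=> //=; apply/andP; split; first by lia.
  by apply/allP => y ya; have := ha y ya; have := hs y ya; rewrite /=; lia.
- by apply/andP; split=> //; apply/allP => x /h; lia.
- apply/andP; split=> /=.
    rewrite path_sortedE ?sb ?andbT; last by move=> ? ? ? /=; lia.
    by apply/allP => x /h /=; lia.
  by apply/andP; split; [lia|apply/allP => x /h; lia].
Qed.

Lemma distinct_partsS_disjoint s i :
  distinct_parts s i `&` cons (s + i.+1)%N @` distinct_parts s i `<=` set0.
Proof.
by move=> a [/andP[_ /allP h] [b _ E]]; have := h (s + i.+1)%N;
  rewrite -E inE eqxx => /(_ isT); lia.
Qed.

(** Here the largest part may repeat, so the tail stays in the same family; this self-reference
    produces a delay recursion, hence a denominator. *)
Lemma bounded_partsS l :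
  bounded_parts l.+1 = bounded_parts l `|` cons l.+1 @` bounded_parts l.+1.
Proof.
apply/seteqP; split=> [a|a [/andP[sa /allP h]|[b /andP[sb /allP h] <-]]].
- case: a => [|x a /=] /andP[sa]; first by left.
  move=> /= /andP[hx ha].
  have /allP hs : all (geq x) a by rewrite (order_path_min _ sa)// => ? ? ? /=; lia.
  have [xE|xE] := eqVneq x l.+1.
    right; exists a; rewrite ?xE//; apply/andP; split=> //; exact: path_sorted sa.
  left; apply/andP; split=> //=; apply/andP; split; first by lia.
  by apply/allP => y ya; have := allP ha y ya; have := hs y ya; rewrite /=; lia.
- by apply/andP; split=> //; apply/allP => x /h; lia.
- apply/andP; split=> /=.
    rewrite path_sortedE ?sb ?andbT; last by move=> ? ? ? /=; lia.
    by apply/allP => x /h /=; lia.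
  by apply/andP; split; [lia|apply/allP => x /h; lia].
Qed.

Lemma bounded_partsS_disjoint l :
  bounded_parts l `&` cons l.+1 @` bounded_parts l.+1 `<=` set0.
Proof.
by move=> a [/andP[_ /allP h] [b _ E]]; have := h l.+1;
  rewrite -E inE eqxx => /(_ isT); lia.
Qed.

Lemma geq_trans : transitive geq.
Proof. by move=> ? ? ? /=; lia. Qed.

(* Either the last row has length j, or every row can be shortened by one. *)
Lemma square_rowsS j k :
  square_rows j k.+1 =
  rcons^~ j @` square_rows j k `|` map succn @` square_rows j k.+1.
Proof.
apply/seteqP; split=> [b|b [[a /and3P[sz sa ha] <-]|[a /and3P[sz sa ha] <-]]].
- case/lastP: b => [|b x] /and3P[//]; rewrite size_rcons eqSS => sz.
  rewrite !(sorted_pairwise geq_trans) pairwise_rcons all_rcons.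
  move=> /andP[bx sb] /andP[jx jb].
  have [<-|xj] := eqVneq x j.
    left; exists b => //; apply/and3P; split=> //.
      by rewrite (sorted_pairwise geq_trans).
  right; have jrb : all (ltn j) (rcons b x).
    by rewrite all_rcons; apply/andP; split;
      [rewrite /=; lia|apply/allP => y yb; have := allP bx y yb; rewrite /=; lia].
  exists (map predn (rcons b x)); last first.
    rewrite -map_comp -[RHS]map_id; apply/eq_in_map => y /(allP jrb) /=; lia.
  apply/and3P; split; first by rewrite size_map size_rcons.
    rewrite (sorted_pairwise geq_trans) pairwise_map.
    apply: (@sub_pairwise _ geq); first by move=> ? ? /=; lia.
    by rewrite pairwise_rcons sb bx.
  by rewrite all_map; apply: sub_all jrb => y /=; lia.
- apply/and3P; split; first by rewrite size_rcons.
    by move: sa; rewrite !(sorted_pairwise geq_trans) pairwise_rcons => ->;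
      rewrite andbT.
  by rewrite all_rcons leqnn.
- apply/and3P; split; first by rewrite size_map.
    by rewrite sorted_map.
  by rewrite all_map; apply: sub_all ha => y /=; lia.
Qed.

Lemma square_rowsS_disjoint j k :
  rcons^~ j @` square_rows j k `&` map succn @` square_rows j k.+1 `<=` set0.
Proof.
move=> a [[b _ <-] [c /and3P[_ _ /allP h]]] E.
have : j \in map succn c by rewrite E mem_rcons inE eqxx.
by move=> /mapP[x /h]; lia.
Qed.

(** * Effect of each removal on the weight *)

(** The exponent of [z] is the rank when there are exactly [j] rows. It subtracts [j] rather than
    the number of rows, so that adding a row of length [j] leaves it unchanged. *)
Definition tweight {F : fieldType} (z q : F) (j : nat) (t : triple) : F :=
  (-1) ^+ size t.1.1 * z ^ ((head j t.1.2)%:Z - j%:Z - (size t.2)%:Z) *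
  q ^+ tsize t.

Lemma tweight_cons1 (F : fieldType) (z q : F) (j x : nat) (t : triple) :
  tweight z q j (on1 (cons x) t) = - q ^+ x * tweight z q j t.
Proof.
rewrite /tweight /tsize /= -!addnA exprD exprS !mulN1r !mulNr.
by congr (- _); rewrite !mulrA; congr (_ * _); rewrite mulrC !mulrA.
Qed.

Lemma tweight_rcons2 (F : fieldType) (z q : F) (j : nat) (t : triple) :
  tweight z q j (on2 (rcons^~ j) t) = q ^+ j * tweight z q j t.
Proof.
rewrite /tweight /tsize /= sumn_rcons.
(* For an empty sequence both sides equal [j], thanks to the default value. *)
have -> : head j (rcons t.1.2 j) = head j t.1.2 by case: t.1.2.
rewrite (_ : (sumn t.1.1 + (sumn t.1.2 + j) + sumn t.2 =
   j + (sumn t.1.1 + sumn t.1.2 + sumn t.2))%N); last by lia.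
by rewrite exprD mulrCA.
Qed.

Lemma sumn_map_succn s : sumn (map succn s) = (sumn s + size s)%N.
Proof. by elim: s => //= x s ->; lia. Qed.

(** The new first column has [k.+1] cells and lengthens the first row, which exists because the
    number of rows is nonzero. *)
Lemma tweight_succ2 (F : fieldType) (z q : F) (j k : nat) (t : triple) :
  z != 0 -> size t.1.2 = k.+1 ->
  tweight z q j (on2 (map succn) t) = z * q ^+ k.+1 * tweight z q j t.
Proof.
move=> z0 sz; rewrite /tweight /tsize /= sumn_map_succn sz.
rewrite (_ : (sumn t.1.1 + (sumn t.1.2 + k.+1) + sumn t.2 =
   k.+1 + (sumn t.1.1 + sumn t.1.2 + sumn t.2))%N); last by lia.
have -> : head j (map succn t.1.2) = (head j t.1.2).+1 by case: t.1.2 sz.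
rewrite exprD (_ : ((head j t.1.2).+1%:Z - j%:Z - (size t.2)%:Z =
   1 + ((head j t.1.2)%:Z - j%:Z - (size t.2)%:Z))%R); last by lia.
rewrite (expfzDr 1 _ z0)// expr1z; move: (z ^ _) (q ^+ k.+1) (q ^+ _) => u v w.
by move: ((-1) ^+ _) => e; ring.
Qed.

Lemma tweight_cons3 (F : fieldType) (z q : F) (j x : nat) (t : triple) :
  z != 0 ->
  tweight z q j (on3 (cons x) t) = z^-1 * q ^+ x * tweight z q j t.
Proof.
move=> z0; rewrite /tweight /tsize /=.
rewrite (_ : (sumn t.1.1 + sumn t.1.2 + (x + sumn t.2) =
   x + (sumn t.1.1 + sumn t.1.2 + sumn t.2))%N); last by lia.
rewrite exprD (_ : ((head j t.1.2)%:Z - j%:Z - (size t.2).+1%:Z =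
   -1 + ((head j t.1.2)%:Z - j%:Z - (size t.2)%:Z))%R); last by lia.
rewrite (expfzDr (-1) _ z0)// exprN1; move: (z ^ _) (q ^+ x) (q ^+ _) => u v w.
by move: ((-1) ^+ _) => e; ring.
Qed.

(** * Limits of the partial sums *)

Lemma nil_pos : [set [::]] `<=` positive_seqs.
Proof. by move=> _ ->. Qed.

Lemma cvg_subn (R : realType) (u : nat -> R[i]) (l : R[i]) (d : nat) :
  (u : nat -> R[i]^o) @ \oo --> (l : R[i]^o) ->
  (fun M => u (M - d)%N : R[i]^o) @ \oo --> (l : R[i]^o).
Proof. exact: cvg_comp (cvg_subnr d). Qed.

Lemma cvg_scale (R : realType) (u : nat -> R[i]) (c l : R[i]) :
  (u : nat -> R[i]^o) @ \oo --> (l : R[i]^o) ->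
  (fun M => c * u M : R[i]^o) @ \oo --> (c * l : R[i]^o).
Proof.
move=> ul; refine (@cvgM _ _ _ _ (fun=> c) u c l _ ul); exact: cvg_cst.
Qed.

Lemma cvg_add (R : realType) (u v : nat -> R[i]) (k l : R[i]) :
  (u : nat -> R[i]^o) @ \oo --> (k : R[i]^o) ->
  (v : nat -> R[i]^o) @ \oo --> (l : R[i]^o) ->
  (fun M => u M + v M : R[i]^o) @ \oo --> (k + l : R[i]^o).
Proof. by move=> uk vl; refine (@cvgD _ R[i]^o _ _ _ u v k l uk vl). Qed.

Lemma psum_triples_nil (R : realType) (z q : R[i]) (j : nat) :
  (psum ([set [::]] `*` [set [::]] `*` [set [::]]) tsize (tweight z q j)
    : nat -> R[i]^o) @ \oo --> (1 : R[i]^o).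
Proof.
(* The bound on the size is strict, so the empty triple is counted only from [M = 1] on. *)
apply: cvg_near_cst; exists 1%N => //= M /= M1; rewrite /psum.
rewrite (_ : _ `&` _ = [set ([::], [::], [::])]).
  by rewrite fsbig_set1 /tweight /= subrr !mul1r.
apply/seteqP; split; first by move=> [[a b] c] [[[/= -> ->] ->] _].
by move=> _ ->.
Qed.

(** A last row of length [j] contributes [q ^+ j] and leads back to [k] rows; a first column
    contributes [z * q ^+ k.+1] and keeps [k.+1] rows, giving the new denominator. *)
Lemma psum_square_rows_cvg (R : realType) (z q : R[i]) (j k : nat) :
  z != 0 -> `|q| < 1 -> `|z * q| < 1 -> (0 < j)%N ->
  (psum ([set [::]] `*` square_rows j k `*` [set [::]]) tsize (tweight z q j)
    : nat -> R[i]^o) @ \oo --> (q ^+ (j * k) / qpoch (z * q) q k : R[i]^o).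
Proof.
move=> z0 q1 zq1 j0; elim: k => [|k IH].
  rewrite square_rows0 muln0 expr0 /qpoch big_ord0 divr1.
  exact: psum_triples_nil.
rewrite (_ : q ^+ _ / _ =
  q ^+ j * (q ^+ (j * k) / qpoch (z * q) q k) / (1 - z * q * q ^+ k)); last first.
  by rewrite /qpoch big_ord_recr /= invfM mulnS exprD !mulrA.
pose P M := psum ([set [::]] `*` square_rows j k `*` [set [::]]) tsize
  (tweight z q j) M.
apply: (@delay_recursion_cvg _ _ (fun M => q ^+ j * P (M - j)%N) _ _ k.+1); first by [].
(* The ratio is [z * q * q ^+ k], of norm at most [|z * q|] since [|q| < 1]. *)
- rewrite normrM -[ltRHS]mulr1.
  rewrite (le_lt_trans (ler_piMr _ _)) ?normr_ge0 ?normrX ?exprn_ile1//.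
    exact: ltW.
  by rewrite mulr1.
- move=> M; rewrite {1}square_rowsS.
  rewrite (_ : _ `*` (_ `|` _) `*` _ =
    ([set [::]] `*` (rcons^~ j @` square_rows j k) `*` [set [::]]) `|`
    ([set [::]] `*` (map succn @` square_rows j k.+1) `*` [set [::]])); last first.
    by apply/seteqP; split=> [t [[? [|]] ?]|t [|] [[? ?] ?]];
      [left|right|split=> //; split=> //; left|split=> //; split=> //; right].
  rewrite psumU.
  + congr (_ + _).
      rewrite on2_image (@psum_image _ _ _ _ _ tsize _ (tweight z q j) _ j (q ^+ j)) //.
      * by apply: on2_inj; exact: rcons_injl.
      * by move=> t _; rewrite /tsize /= sumn_rcons; lia.
      * by move=> t _; exact: tweight_rcons2.
    rewrite on2_image.
    rewrite (@psum_image _ _ _ _ _ tsize _ (tweight z q j) _ k.+1 (z * q ^+ k.+1)).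
    * by rewrite exprS !mulrA.
    * by apply: on2_inj; apply: inj_map => x y [].
    * move=> t [[_ /and3P[/eqP sz _ _]] _].
      by rewrite /tsize /= sumn_map_succn sz; lia.
    * by move=> t [[_ /and3P[/eqP sz _ _]] _]; exact: tweight_succ2.
  + apply: finite_triples; try exact: nil_pos.
    by apply: subset_trans (@square_rows_pos j k.+1 j0); rewrite square_rowsS; left.
  + apply: finite_triples; try exact: nil_pos.
    by apply: subset_trans (@square_rows_pos j k.+1 j0);
      rewrite [X in _ `<=` X]square_rowsS; right.
  + by move=> t [[[_ h1] _] [[_ h2] _]]; apply: (@square_rowsS_disjoint j k t.1.2).
- apply: cvg_scale; apply: cvg_subn; exact: IH.
Qed.

(** Stated for arbitrary [B] and [L], so that this factor can be attached to the limit already found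
    for the square rows. Each part below the square lowers the rank by one, whence [z^-1]. *)
Lemma psum_bounded_parts_cvg (R : realType) (z q L : R[i]) (j l : nat)
    (B : set (seq nat)) :
  z != 0 -> `|q| < 1 -> `|z^-1 * q| < 1 -> B `<=` positive_seqs ->
  (psum ([set [::]] `*` B `*` [set [::]]) tsize (tweight z q j)
    : nat -> R[i]^o) @ \oo --> (L : R[i]^o) ->
  (psum ([set [::]] `*` B `*` bounded_parts l) tsize (tweight z q j)
    : nat -> R[i]^o) @ \oo --> (L / qpoch (z^-1 * q) q l : R[i]^o).
Proof.
move=> z0 q1 zq1 Bpos cvB; elim: l => [|l IH].
  by rewrite bounded_parts0 /qpoch big_ord0 divr1.
rewrite (_ : L / _ =
  L / qpoch (z^-1 * q) q l / (1 - z^-1 * q * q ^+ l)); last first.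
  by rewrite /qpoch big_ord_recr /= invfM !mulrA.
apply: (@delay_recursion_cvg _ _
  (psum ([set [::]] `*` B `*` bounded_parts l) tsize (tweight z q j))
  _ _ l.+1); [by []| | |exact: IH].
- rewrite normrM -[ltRHS]mulr1.
  rewrite (le_lt_trans (ler_piMr _ _)) ?normr_ge0 ?normrX ?exprn_ile1//.
    exact: ltW.
  by rewrite mulr1.
- move=> M; rewrite {1}bounded_partsS.
  rewrite (_ : _ `*` (_ `|` _) =
    ([set [::]] `*` B `*` bounded_parts l) `|`
    ([set [::]] `*` B `*` (cons l.+1 @` bounded_parts l.+1))); last first.
    by apply/seteqP; split=> [t [? [|]]|t [|] [? ?]];
      [left|right|split=> //; left|split=> //; right].
  rewrite psumU.
  + congr (_ + _); rewrite on3_image.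
    rewrite (@psum_image _ _ _ _ _ tsize _ (tweight z q j) _ l.+1 (z^-1 * q ^+ l.+1)).
    * by rewrite exprS !mulrA.
    * by apply: on3_inj => x y [].
    * by move=> t _; rewrite /tsize /=; lia.
    * by move=> t _; exact: tweight_cons3.
  + by apply: finite_triples => //; [exact: nil_pos|exact: bounded_parts_pos].
  + apply: finite_triples => //; first exact: nil_pos.
    apply: subset_trans (@bounded_parts_pos l.+1).
    by rewrite [X in _ `<=` X]bounded_partsS; right.
  + by move=> t [[_ h1] [_ h2]]; apply: (@bounded_partsS_disjoint l t.2).
Qed.

(** The part [s + i.+1] is absent or occurs once with a sign, so each induction step multiplies the
    limit by [1 - q ^+ (s + i.+1)]. *)
Lemma psum_distinct_parts_cvg (R : realType) (z q L : R[i]) (j s i : nat)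
    (B C : set (seq nat)) :
  B `<=` positive_seqs -> C `<=` positive_seqs ->
  (psum ([set [::]] `*` B `*` C) tsize (tweight z q j)
    : nat -> R[i]^o) @ \oo --> (L : R[i]^o) ->
  (psum (distinct_parts s i `*` B `*` C) tsize (tweight z q j)
    : nat -> R[i]^o) @ \oo --> (L * qpoch (q ^+ s.+1) q i : R[i]^o).
Proof.
move=> Bpos Cpos cvBC; elim: i => [|i IH].
  by rewrite distinct_parts0 /qpoch big_ord0 mulr1.
rewrite (_ : L * _ = L * qpoch (q ^+ s.+1) q i +
   - q ^+ (s + i.+1) * (L * qpoch (q ^+ s.+1) q i)); last first.
  rewrite /qpoch big_ord_recr /= -exprD addSnnS.
  rewrite mulrBr mulr1 mulrBr mulrA mulNr.
  by congr (_ - _); rewrite mulrC.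
pose P M := psum (distinct_parts s i `*` B `*` C) tsize (tweight z q j) M.
rewrite (_ : psum _ _ _ =
  (fun M => P M + - q ^+ (s + i.+1) * P (M - (s + i.+1))%N)); last first.
  apply/funext => M; rewrite distinct_partsS.
  rewrite (_ : (_ `|` _) `*` _ `*` _ =
    (distinct_parts s i `*` B `*` C) `|`
    ((cons (s + i.+1)%N @` distinct_parts s i) `*` B `*` C)); last first.
    by apply/seteqP; split=> [t [[[|] ?] ?]|t [|] [[? ?] ?]];
      [left|right|split=> //; split=> //; left|split=> //; split=> //; right].
  rewrite psumU.
  - congr (_ + _); rewrite on1_image.
    rewrite (@psum_image _ _ _ _ _ tsize _ (tweight z q j) _ (s + i.+1)
      (- q ^+ (s + i.+1)))//.
    + by apply: on1_inj => x y [].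
    + by move=> t _; rewrite /tsize /=; lia.
    + by move=> t _; exact: tweight_cons1.
  - by apply: finite_triples => //; exact: distinct_parts_pos.
  - apply: finite_triples => //.
    apply: subset_trans (@distinct_parts_pos s i.+1).
    by rewrite [X in _ `<=` X]distinct_partsS; right.
  - by move=> t [[[h1 _] _] [[h2 _] _]]; apply: (@distinct_partsS_disjoint s i t.1.1).
apply: cvg_add; first exact: IH.
apply: cvg_scale; apply: cvg_subn; exact: IH.
Qed.

(** * Durfee squares and the vector partitions *)

Lemma leq_durfee (s : seq nat) (d : nat) :
  (d <= count (leq d) s)%N -> (d <= durfee s)%N.
Proof.
move=> ds; have dsz : (d < (size s).+1)%N by rewrite ltnS (leq_trans ds) ?count_size.
exact: (@leq_bigmax_cond _ _ (fun i : 'I_(size s).+1 => i : nat) (Ordinal dsz)).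
Qed.

Lemma durfee_count (s : seq nat) : (durfee s <= count (leq (durfee s)) s)%N.
Proof.
rewrite /durfee.
have [|i ic ->] := @eq_bigmax_cond _
    (fun d : 'I_(size s).+1 => (d <= count (leq d) s)%N)
    (fun d => d : nat); last exact: ic.
(* The value 0 always qualifies, so the maximum is attained. *)
by apply/card_gt0P; exists ord0.
Qed.

(** Let [j] be the Durfee size. A short row among the first [j] would leave fewer than [j] rows of
    length at least [j]; a later row longer than [j] would make room for a square of size [j.+1]. *)
Lemma durfee_square (s : seq nat) : sorted geq s ->
  all (leq (durfee s)) (take (durfee s) s) && all (geq (durfee s)) (drop (durfee s) s).
Proof.
set j := durfee s; rewrite (sorted_pairwise geq_trans) -{1}(cat_take_drop j s).
rewrite pairwise_cat => /and3P[/allrelP td _ _].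
have := durfee_count s; rewrite -/j => jc.
have jsz : (j <= size s)%N by rewrite (leq_trans jc) ?count_size.
have tsz : size (take j s) = j by rewrite size_takel.
apply/andP; split; apply/allP => x xs; rewrite /= leqNgt; apply/negP => xj.
  move: jc; rewrite -{1}(cat_take_drop j s) count_cat.
  have -> : count (leq j) (drop j s) = 0%N.
    apply/eqP; rewrite -leqn0 leqNgt -has_count; apply/hasPn => y ys.
    by have := td x y xs ys; rewrite /=; lia.
  have : count (leq j) (take j s) != size (take j s).
    by rewrite -all_count; apply/allPn; exists x => //; rewrite -ltnNge.
  by have := count_size (leq j) (take j s); lia.
suff : (j.+1 <= j)%N by rewrite ltnn.
apply: leq_durfee; rewrite -(cat_take_drop j s) count_cat.
have /eqP -> : count (leq j.+1) (take j s) == size (take j s).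
  by rewrite -all_count; apply/allP => y ys; have := td y x ys xs; rewrite /=; lia.
rewrite tsz -addn1 leq_add2l -has_count; apply/hasP; exists x => //.
by rewrite /= addn1.
Qed.

(** Rows longer than [j] can come only from [b], and there are just [j] of those, so no larger
    square fits. *)
Lemma durfee_cat (j : nat) (b c : seq nat) :
  square_rows j j b -> bounded_parts j c -> durfee (b ++ c) = j.
Proof.
move=> /and3P[/eqP sb _ hb] /andP[_ hc]; apply/eqP; rewrite eqn_leq; apply/andP; split.
  rewrite leqNgt; apply/negP => jd; have := durfee_count (b ++ c).
  rewrite count_cat (_ : count _ c = 0%N); last first.
    apply/eqP; rewrite -leqn0 leqNgt -has_count; apply/hasPn => y /(allP hc).
    by rewrite /=; lia.
  by have := count_size (leq (durfee (b ++ c))) b; lia.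
by apply: leq_durfee; move: hb; rewrite count_cat all_count sb => /eqP->; lia.
Qed.

Lemma largest_part_cons (x : nat) (s : seq nat) :
  path geq x s -> largest_part (x :: s) = x.
Proof.
rewrite (path_sortedE geq_trans) => /andP[/allP h _].
rewrite /largest_part big_cons; apply/maxn_idPl/bigmax_leqP_seq => y ys _.
exact: h.
Qed.

Definition glue (t : triple) : vpart := (t.1.1, t.1.2 ++ t.2).

(** The second partition is cut after its first [j] rows, the height of its Durfee square. *)
Lemma S1_glue (N j : nat) : (0 < j <= N)%N ->
  S1 N j =
  glue @` (distinct_parts (N - j) j `*` square_rows j j `*` bounded_parts j).
Proof.
move=> /andP[j0 jN]; apply/seteqP; split.
  move=> [a p] [[/= /andP[/andP[sa a0] ua] /andP[sp p0]] ha hj].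
  exists (a, take j p, drop j p); last by rewrite /glue /= cat_take_drop.
  have := durfee_square p sp; rewrite hj => /andP[h1 h2].
  have jp : (j <= size p)%N.
    by rewrite -[leqLHS]hj (leq_trans (durfee_count p)) ?count_size.
  split; first split => /=.
  - apply/andP; split; first by rewrite gtn_sorted_uniq_geq ua.
    by case: ha => [->//|ha]; apply/allP => x /ha; lia.
  - by apply/and3P; split=> //; [rewrite size_takel|exact: take_sorted].
  - apply/andP; split; first exact: drop_sorted.
    apply/allP => x xp; have := allP h2 x xp; rewrite /= => ->; rewrite andbT lt0n.
    by apply: contraNneq p0 => <-; exact: mem_drop xp.
move=> _ [[[a b] c] [[/= ha hb] hc] <-].
have a0 := @distinct_parts_pos _ _ _ ha.
have b0 := @square_rows_pos _ _ j0 _ hb.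
have c0 := @bounded_parts_pos _ _ hc.
(* The bound on the parts holds vacuously for an empty first partition, so the right alternative
   always works. *)
split; [split|right|exact: durfee_cat].
- move: ha => /andP[]; rewrite gtn_sorted_uniq_geq => /andP[ua sa] _.
  by rewrite /is_distinct_partition /is_partition sa ua andbT.
- apply/andP; split; last by rewrite mem_cat negb_or; apply/andP.
  move: hb hc => /and3P[_ sb /allP hb] /andP[sc /allP hc].
  move: sb sc; rewrite !(sorted_pairwise geq_trans) pairwise_cat => -> ->.
  by rewrite !andbT; apply/allrelP => x y /hb /= ? /hc /=; lia.
- by move: ha => /andP[_ /allP ha] x /ha; lia.
Qed.

(** Since [j] is positive, the largest part is the head of the first [j] rows, and there are
    [j + size t.2] parts. *)
Lemma vrank_glue (j : nat) (t : triple) : (0 < j)%N ->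
  square_rows j j t.1.2 -> bounded_parts j t.2 ->
  vrank (glue t) = (head j t.1.2)%:Z - j%:Z - (size t.2)%:Z.
Proof.
case: t => [[a b] c] j0 /= hb hc; rewrite /vrank /partition_rank /=.
case: b hb => [|x b] hb; first by move: hb j0 => /and3P[/= /eqP<-].
rewrite cat_cons largest_part_cons /=; last first.
  move: hb hc => /and3P[_ sb /allP hb] /andP[sc /allP hc].
  move: sb sc; rewrite /= cat_path => ->; rewrite /=.
  case: c hc => //= y c hc ->; rewrite andbT.
  have := hb (last x b) (mem_last _ _); have := hc y (mem_head _ _).
  by rewrite /=; lia.
move: hb => /and3P[/= /eqP<- _ _]; rewrite size_cat; lia.
Qed.

Definition vweight {F : fieldType} (z q : F) (p : vpart) : F :=
  (weight_r p)%:~R * z ^ vrank p * q ^+ vsize p.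

Lemma psum_S1 (F : fieldType) (z q : F) (N j M : nat) : (0 < j <= N)%N ->
  psum (S1 N j) vsize (vweight z q) M =
  psum (distinct_parts (N - j) j `*` square_rows j j `*` bounded_parts j)
    tsize (tweight z q j) M.
Proof.
move=> jN; have /andP[j0 _] := jN; rewrite S1_glue//.
rewrite (@psum_image _ _ _ _ _ tsize _ (tweight z q j) _ 0 1).
- by rewrite mul1r subn0.
(* Injectivity of [glue]: the first block has fixed length [j], so the concatenation determines
   where it was cut. *)
- move=> [[a b] c] [[a' b'] c']; rewrite !inE => -[[_ /and3P[/eqP/= sb _ _]] _].
  move=> [[_ /and3P[/eqP/= sb' _ _]] _] [-> /eqP].
  by rewrite eqseq_cat ?sb ?sb'// => /andP[/eqP-> /eqP->].
- by move=> t _; rewrite /vsize /tsize /= sumn_cat addnA addn0.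
- move=> t [[_ hb] hc]; rewrite mul1r /vweight /tweight (vrank_glue j) //.
  by rewrite /vsize /tsize /= sumn_cat addnA /weight_r rmorphXn rmorphN1.
Qed.

(** * Regrouping by size and rank *)

Lemma sum_fibers (V : nmodType) (T K : eqType) (A : seq K) (s : seq T)
    (f : T -> K) (P : pred T) (F : T -> V) :
  uniq A -> {in s, forall p, P p -> f p \in A} ->
  \sum_(k <- A) \sum_(p <- s | P p && (f p == k)) F p = \sum_(p <- s | P p) F p.
Proof.
move=> uA fA; rewrite (exchange_big_dep P)//=; last by move=> ? ? _ /andP[].
rewrite [LHS]big_seq_cond [RHS]big_seq_cond; apply: eq_bigr => p /andP[ps Pp].
rewrite -big_filter (_ : seq.filter _ _ = [:: f p]) ?big_seq1//.
rewrite -(filter_pred1_uniq uA (fA _ ps Pp)); apply: eq_filter => k /=.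
by rewrite Pp eq_sym.
Qed.

(** A nonempty Durfee square forces positive size, so starting the series at [n = 1] loses
    nothing. *)
Lemma vsize_gt0 (N j : nat) (p : vpart) : (0 < j)%N -> S1 N j p -> (0 < vsize p)%N.
Proof.
case: p => [a [|x s]] j0 [[_ /andP[_ p0]] _ hd].
  by have := durfee_count [::]; rewrite hd /=; lia.
by move: p0; rewrite /vsize /= inE negb_or; lia.
Qed.

(** For fixed [M] both sides are finite sums over the same vector partitions; fibers of the rank and
    then of the size are merged. *)
Lemma sum_NS1_psum (F : fieldType) (z q : F) (N M : nat) :
  \sum_(1 <= n < M.+1) \sum_(m \in [set: int]) (NS1 N m n)%:~R * z ^ m * q ^+ n =
  \sum_(1 <= j < N.+1) psum (S1 N j) vsize (vweight z q) M.+1.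
Proof.
pose X j := S1 N j `&` [set p | (vsize p < M.+1)%N].
have finX j : finite_set (X j).
  apply: (@sub_finite_set _ _
    (\bigcup_(n in `I_M.+1) [set p | S1 N j p /\ vsize p = n])).
    by move=> p [Sp pM]; exists (vsize p).
  by apply: bigcup_finite; [exact: finite_II|move=> n _; exact: S1_size_finite].
pose s j : seq vpart := finmap.enum_fset (fset_set (X j)).
have sP j p : p \in s j -> X j p by rewrite /s in_fset_set// inE.
have NS1jE m n j : (n < M.+1)%N ->
    NS1j N m n j = \sum_(p <- s j | (vsize p == n) && (vrank p == m)) weight_r p.
  move=> nM; rewrite /NS1j.
  have -> : S1_fiber N m n j = X j `&` [set p | (vsize p == n) && (vrank p == m)].
    apply/seteqP; split=> p.
      by move=> [Sp /= pn pm]; rewrite pn pm !eqxx; split=> //; split=> //=; rewrite pn.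
    by move=> [[Sp _] /= /andP[/eqP pn /eqP pm]].
  rewrite fsbig_mkcondr fsbig_finite// [RHS]big_mkcond; apply: eq_bigr => p _.
  by rewrite mem_setE.
(* A finite list of all ranks that occur; outside it every fiber is empty, so the sum over all
   integers reduces to [A]. *)
pose A := undup [seq vrank p | j <- iota 1 N, p <- s j].
have inA j p : (1 <= j < N.+1)%N -> p \in s j -> vrank p \in A.
  move=> jN ps; rewrite mem_undup; apply/allpairsPdep; exists j, p; split=> //.
  by rewrite mem_iota add1n.
have inner n : (1 <= n < M.+1)%N ->
    \sum_(m \in [set: int]) (NS1 N m n)%:~R * z ^ m * q ^+ n =
    \sum_(1 <= j < N.+1) \sum_(p <- s j | vsize p == n) vweight z q p.
  move=> /andP[n1 nM].
  transitivity (\sum_(m <- A) (NS1 N m n)%:~R * z ^ m * q ^+ n).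
    rewrite (fsbigE A) ?undup_uniq//; first by apply: eq_bigl => m; rewrite in_setT.
    move=> m _ mA; rewrite /NS1 big_nat_cond big1 ?mul0r// => j.
    rewrite andbT => jN; rewrite NS1jE// big_seq_cond big1// => p.
    by move=> /and3P[ps _ /eqP pm]; move: mA; rewrite -pm (inA j).
  transitivity (\sum_(m <- A) \sum_(1 <= j < N.+1)
      \sum_(p <- s j | (vsize p == n) && (vrank p == m)) vweight z q p).
    apply: eq_bigr => m _; rewrite /NS1 rmorph_sum !mulr_suml.
    apply: eq_bigr => j _; rewrite NS1jE// rmorph_sum !mulr_suml.
    by apply: eq_bigr => p /andP[/eqP<- /eqP<-].
  rewrite exchange_big /=; apply: eq_big_nat => j jN.
  by apply: sum_fibers; [exact: undup_uniq|move=> p ps _; exact: inA ps].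
rewrite (eq_big_nat _ _ inner) exchange_big /=; apply: eq_big_nat => j /andP[j0 jN].
rewrite /psum fsbig_finite; last exact: finX.
apply: (@sum_fibers _ _ _ _ _ vsize predT); first exact: iota_uniq.
move=> p /sP[Sp pM] _; rewrite mem_index_iota; apply/andP; split=> //.
exact: vsize_gt0 Sp.
Qed.

(** * Termwise limits and the q-binomial factor *)

Lemma cvg_succn (R : realType) (u : nat -> R[i]) (l : R[i]) :
  (u : nat -> R[i]^o) @ \oo --> (l : R[i]^o) ->
  (fun M => u M.+1 : R[i]^o) @ \oo --> (l : R[i]^o).
Proof. by rewrite -(@cvg_shiftS R[i]^o u (nbhs (l : R[i]^o))). Qed.

Lemma cvg_sum_seq (R : realType) (T : eqType) (r : seq T)
    (u : T -> nat -> R[i]) (l : T -> R[i]) :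
  {in r, forall j, (u j : nat -> R[i]^o) @ \oo --> (l j : R[i]^o)} ->
  (fun M => \sum_(j <- r) u j M : R[i]^o) @ \oo -->
  (\sum_(j <- r) l j : R[i]^o).
Proof.
elim: r => [|j r IH] h.
  rewrite big_nil; under eq_fun do rewrite big_nil; exact: cvg_cst.
rewrite big_cons; under eq_fun do rewrite big_cons.
apply: cvg_add; first by apply: h; rewrite mem_head.
by apply: IH => k kr; apply: h; rewrite inE kr orbT.
Qed.

Lemma qpoch_cat (F : fieldType) (q : F) (s j : nat) :
  qpoch q q (s + j) = qpoch q q s * qpoch (q ^+ s.+1) q j.
Proof.
rewrite /qpoch big_split_ord /=; congr (_ * _); apply: eq_bigr => i _.
by rewrite -!exprS -exprD.
Qed.

Lemma qpoch_neq0 (R : realType) (q : R[i]) (n : nat) :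
  `|q| < 1 -> qpoch q q n != 0.
Proof.
move=> q1; apply/prodf_neq0 => i _; rewrite subr_eq0 -exprS.
apply: contraTneq (exprn_ilt1 i.+1 (normr_ge0 q) q1) => //.
by rewrite -normrX => <-; rewrite normr1 ltxx.
Qed.

(** Since [(q)_N = (q)_(N-j) * (q^(N-j+1))_j], the q-binomial times [(q)_j] is exactly the factor
    coming from the distinct parts. *)
Lemma qbinom_mul_qpoch (F : fieldType) (q x a b : F) (N j : nat) : (j <= N)%N ->
  qpoch q q j != 0 -> qpoch q q (N - j) != 0 ->
  qbinom q N j * (x * qpoch q q j / (a * b)) =
  x / a / b * qpoch (q ^+ (N - j).+1) q j.
Proof.
move=> jN; rewrite /qbinom [(a * b)^-1]invfM.
have -> : qpoch q q N = qpoch q q (N - j) * qpoch (q ^+ (N - j).+1) q j.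
  by rewrite -qpoch_cat subnK.
move: a^-1 b^-1 (qpoch q q j) (qpoch q q _) (qpoch (q ^+ _) q j).
by move=> a' b' u v w u0 v0; field; rewrite ?u0 ?v0.
Qed.

(** The series in [n] is the limit of its partial sums; for each [n] the sum over [m] has finite
    support. *)
Theorem theorem2p2 (R : realType) (N : nat) (z q : R[i])
    (hz : z != 0) (hzq : `|z * q| < 1) (hzVq : `|z^-1 * q| < 1) :
  (fun M : nat => \sum_(1 <= n < M.+1)
     \sum_(m \in [set: int]) (NS1 N m n)%:~R * z ^ m * q ^+ n : R[i]^o) @ \oo -->
  (\sum_(1 <= j < N.+1)
     qbinom q N j * (q ^+ (j ^ 2) * qpoch q q j /
       (qpoch (z * q) q j * qpoch (z^-1 * q) q j)) : R[i]^o).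
Proof.
(* The product of the two bounded norms is [|q| ^+ 2]. *)
have q1 : `|q| < 1.
  rewrite -(@expr_lt1 _ 2)//.
  have -> : `|q| ^+ 2 = `|z * q| * `|z^-1 * q|.
    by rewrite -normrM mulrACA divff// mul1r -expr2 normrX.
  exact: mulr_ilt1.
under eq_fun do rewrite sum_NS1_psum.
apply: cvg_sum_seq => j; rewrite mem_index_iota => jN.
have /andP[j0 jN'] := jN.
under eq_fun do rewrite psum_S1//.
pose P := psum (distinct_parts (N - j) j `*` square_rows j j `*` bounded_parts j)
    tsize (tweight z q j).
suff h : (P : nat -> R[i]^o) @ \oo --> (q ^+ (j * j) / qpoch (z * q) q j /
    qpoch (z^-1 * q) q j * qpoch (q ^+ (N - j).+1) q j : R[i]^o).
  rewrite qbinom_mul_qpoch ?qpoch_neq0// -mulnn.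
  (* Summing up to [n = M] corresponds to the strict size bound [M.+1]. *)
  exact: cvg_succn.
apply: psum_distinct_parts_cvg.
- exact: square_rows_pos.
- exact: bounded_parts_pos.
apply: psum_bounded_parts_cvg => //; first exact: square_rows_pos.
exact: psum_square_rows_cvg.
Qed.
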